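(* Fix a horizon length $T\ge1$. Let $x_0\in X_s$ with $\|x_0\|\le X$, let $\bar\gamma>\underline\gamma$ satisfy $\|w^\star(\bar\gamma)\|=1$ for this $x_0$, and let $u_t^\infty=-K_t^\infty x_t$, $0\le t<T$, be the corresponding finite-horizon $\mathcal H_\infty$ controller (solving the disturbance attenuation problem for horizon length $T$). Let $w=(w_0,\dots,w_{T-1})$ with $\|w\|\le1$ be any disturbance realization and let $\Delta w:=w-w^\star$, $w^\star:=w^\star(\bar\gamma)$. Then the controller attains dynamic regret $$\mathcal R_T(\mathcal H_\infty,w)\;\le\;k_1'\|\Delta w\|+k_2'\|\Delta w\|^2,$$ with constants $k_1',k_2'\in\mathbb R^+$ given by $$k_2'=\|\bar P'\|\left(2+\bar\tau^2\|\bar H\|\,\|\bar P'\|\frac{(1-\bar\eta^T)^2}{(1-\bar\eta)^2}\right),$$ $$k_1'=2\|\bar P'\|\left(2+2\bar\tau\bar\eta(2+X)\Big(\frac{1-\bar\eta^T}{1-\bar\eta}\Big)+\bar\tau^2\|\bar H\|\,\|\bar P'\|\frac{(1-\bar\eta^T)^2}{(1-\bar\eta)^2}\right).$$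
   Context: System and cost. $x_{t+1}=Ax_t+Bu_t+w_t$, with $x_t,w_t\in\mathbb R^n$, $u_t\in\mathbb R^m$, $A\in\mathbb R^{n\times n}$, $B\in\mathbb R^{n\times m}$ known, $x_0\in\mathbb R^n$ with $\|x_0\|\le X$ for a given $X>0$. Cost matrices $Q,Q_T\succeq0$ in $\mathbb R^{n\times n}$ and $R\succ0$ in $\mathbb R^{m\times m}$; $(A,Q)$ is detectable and $(A,B)$ is stabilizable. $J^T(u,w;x_0)=x_T^\top Q_Tx_T+\sum_{t=0}^{T-1}(x_t^\top Qx_t+u_t^\top Ru_t)$. For $w=(w_0,\dots,w_{T-1})$, $\|w\|=(\sum_{t=0}^{T-1}\|w_t\|^2)^{1/2}$. For matrices $\|\cdot\|$ is the spectral norm; $\lambda_{\max},\lambda_{\min}$ are the largest and smallest eigenvalues. $\mathcal H_\infty$ controller (finite horizon). The disturbance attenuation problem is to attain $\inf_\mu\sup_{\|w\|=1}J^T(\mu,w;x_0)^{1/2}$ over policies $\mu$ with access to current and past states. For $\gamma>0$ define backwards, with $M_T(\gamma)=Q_T$, $$\Lambda_t(\gamma)=I+(BR^{-1}B^\top-\gamma^{-2}I)M_{t+1}(\gamma),\qquad M_t(\gamma)=Q+A^\top M_{t+1}(\gamma)\Lambda_t^{-1}(\gamma)A,\qquad 0\le t\le T-1.$$ Let $\underline\gamma$ be the lowest value of $\gamma>0$ for which $\gamma^2I-M_{t+1}(\gamma)\succ0$ for all $t\in\{0,\dots,T-1\}$; when $\gamma$ satisfies this condition every $\Lambda_t(\gamma)$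 is nonsingular. For $\gamma>\underline\gamma$ and initial state $x_0$ define the open-loop worst-case disturbance $$w_t^\star(\gamma)=\gamma^{-2}M_{t+1}(\gamma)\Lambda_t^{-1}(\gamma)A\,x_t^\infty,\qquad x^\infty_{t+1}=\Lambda_t^{-1}(\gamma)Ax_t^\infty,\quad x_0^\infty=x_0,\quad 0\le t<T.$$ The set of admissible initial states is $X_s=\bigcup_{\gamma>\underline\gamma}\{x_0\in\mathbb R^n:\|w^\star(\gamma)\|=1\}$. For $x_0\in X_s$ and $\bar\gamma>\underline\gamma$ with $\|w^\star(\bar\gamma)\|=1$, the finite-horizon $\mathcal H_\infty$ controller is $u^\infty_t=-K_t^\infty x_t$ with $K^\infty_t=R^{-1}B^\top M_{t+1}(\bar\gamma)\Lambda_t^{-1}(\bar\gamma)A$. Put $F_t^\infty=A-BK_t^\infty$. Regret. $\mathcal R_T(\mathcal H_\infty,w)=J^T(u^\infty,w;x_0)-J^T(u^\star,w;x_0)$, where $u^\star=\arg\min_uJ^T(u,w;x_0)$ subject to $x_{t+1}=Ax_t+Bu_t+w_t$ is the optimal offline (noncausal, unrestricted) input sequence chosen with full knowledge of $w$. Constants. $P^\infty_T=Q_T$ and $P_i^\infty=F_i^{\infty\top}P^\infty_{i+1}F_i^\infty+Q+K_i^{\infty\top}RK_i^\infty$ for $0\le i<T$. $P_T=Q_T$ and $P_i=Q+A^\top P_{i+1}A-A^\top P_{i+1}B(R+B^\top P_{i+1}B)^{-1}B^\top P_{i+1}A$ for $0\le i<T$ (the standard LQR Riccati recursion). $\bar P'$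 is a symmetric matrix with $\bar P'\succeq P_i$ and $\bar P'\succeq P_i^\infty$ for all $0\le i\le T$. $\bar H$ is a symmetric matrix with $\bar H\succeq B(R+B^\top P_iB)^{-1}B^\top$ for all $0<i\le T$. $\bar\tau:=\sqrt{\lambda_{\max}(\bar P')/\lambda_{\min}(Q)}$ and $\bar\eta:=\sqrt{1-1/\bar\tau^2}<1$. *)

(* Defs.v *)
From mathcomp Require Import all_boot all_order all_algebra.
From mathcomp Require Import all_classical all_reals.
From mathcomp Require Import complex.

Set Implicit Arguments.
Unset Strict Implicit.
Unset Printing Implicit Defensive.

Import Order.TTheory GRing.Theory Num.Theory.

Local Open Scope classical_set_scope.
Local Open Scope ring_scope.

Section LinearAlgebra.
Context {R : realType}.

Definition qform n (M : 'M[R]_n) (x : 'cV[R]_n) : R := (x^T *m M *m x) 0 0.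

Definition psd n (M : 'M[R]_n) : Prop :=
  M^T = M /\ forall x : 'cV[R]_n, 0 <= qform M x.

Definition posdef n (M : 'M[R]_n) : Prop :=
  M^T = M /\ forall x : 'cV[R]_n, x != 0 -> 0 < qform M x.

(* Euclidean norm; the library norm `|x| on matrices is the max norm. *)
Definition vnorm n (x : 'cV[R]_n) : R := Num.sqrt (\sum_i x i 0 ^+ 2).

(* Norm induced by the Euclidean norms, i.e. the largest singular value. *)
Definition spectral_norm m n (M : 'M[R]_(m, n)) : R :=
  sup [set vnorm (M *m x) | x in [set x : 'cV[R]_n | vnorm x <= 1]].

(* [eigenvalue] only sees eigenvalues in R; these are all of them when M is
   symmetric, the only case in which the next two notions are used. *)
Definition lambda_max n (M : 'M[R]_n) : R := sup [set a : R | eigenvalue M a].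
Definition lambda_min n (M : 'M[R]_n) : R := inf [set a : R | eigenvalue M a].

(* All complex eigenvalues lie in the open unit disc. *)
Definition schur_stable n (M : 'M[R]_n) : Prop :=
  forall z : R[i], eigenvalue (map_mx (real_complex R) M) z -> `|z| < 1.

Definition stabilizable n m (A : 'M[R]_n) (B : 'M[R]_(n, m)) : Prop :=
  exists K : 'M[R]_(m, n), schur_stable (A - B *m K).

Definition detectable n p (A : 'M[R]_n) (C : 'M[R]_(p, n)) : Prop :=
  exists L : 'M[R]_(n, p), schur_stable (A - L *m C).

(* The sequence S_0, ..., S_T with S_T = ST and S_t = f t S_(t+1) for t < T;
   indices beyond T are irrelevant. *)
Fixpoint backward_steps n (f : nat -> 'M[R]_n -> 'M[R]_n) (T : nat)
    (ST : 'M[R]_n) (k : nat) : 'M[R]_n :=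
  if k is k'.+1 then f (T - k'.+1)%N (backward_steps f T ST k') else ST.

Definition backward n (f : nat -> 'M[R]_n -> 'M[R]_n) (T : nat)
    (ST : 'M[R]_n) (t : nat) : 'M[R]_n := backward_steps f T ST (T - t).

Lemma backward_end n (f : nat -> 'M[R]_n -> 'M[R]_n) T ST :
  backward f T ST T = ST.
Proof. by rewrite /backward subnn. Qed.

Lemma backward_rec n (f : nat -> 'M[R]_n -> 'M[R]_n) T ST t : (t < T)%N ->
  backward f T ST t = f t (backward f T ST t.+1).
Proof.
move=> tT; rewrite /backward -(subnSK tT) /=.
by rewrite (subnSK tT) subKn // ltnW.
Qed.

End LinearAlgebra.

Record lq_problem (R : realType) (n m : nat) := LQProblem {
  dynA : 'M[R]_n;
  dynB : 'M[R]_(n, m);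
  costQ : 'M[R]_n;
  costQT : 'M[R]_n;
  costR : 'M[R]_m
}.

Section LQControl.
Context {R : realType} {n m : nat}.
Variables (S : lq_problem R n m) (T : nat).

Local Notation A := (dynA S).
Local Notation B := (dynB S).
Local Notation Q := (costQ S).
Local Notation QT := (costQT S).
Local Notation Rc := (costR S).

(* Disturbances and inputs over the horizon are sequences indexed by nat of
   which only the entries t < T are ever used. *)
Definition seqnorm (w : nat -> 'cV[R]_n) : R :=
  Num.sqrt (\sum_(t < T) vnorm (w t) ^+ 2).

Fixpoint state (u : nat -> 'cV[R]_m) (w : nat -> 'cV[R]_n) (x0 : 'cV[R]_n)
    (t : nat) : 'cV[R]_n :=
  if t is t'.+1 then A *m state u w x0 t' + B *m u t' + w t' else x0.

Definition cost (u : nat -> 'cV[R]_m) (w : nat -> 'cV[R]_n) (x0 : 'cV[R]_n) : R :=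
  qform QT (state u w x0 T)
  + \sum_(t < T) (qform Q (state u w x0 t) + qform Rc (u t)).

Definition hinf_Lambda_of (gamma : R) (M : 'M[R]_n) : 'M[R]_n :=
  1%:M + (B *m invmx Rc *m B^T - (gamma ^- 2)%:M) *m M.

Definition hinf_M (gamma : R) : nat -> 'M[R]_n :=
  backward (fun _ M => Q + A^T *m M *m invmx (hinf_Lambda_of gamma M) *m A) T QT.

Definition hinf_Lambda (gamma : R) (t : nat) : 'M[R]_n :=
  hinf_Lambda_of gamma (hinf_M gamma t.+1).

Definition gamma_low : R :=
  inf [set gamma : R | 0 < gamma /\
    forall t, (t < T)%N -> posdef ((gamma ^+ 2)%:M - hinf_M gamma t.+1)].

Fixpoint wc_state (gamma : R) (x0 : 'cV[R]_n) (t : nat) : 'cV[R]_n :=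
  if t is t'.+1
  then invmx (hinf_Lambda gamma t') *m A *m wc_state gamma x0 t' else x0.

Definition wstar (gamma : R) (x0 : 'cV[R]_n) (t : nat) : 'cV[R]_n :=
  gamma ^- 2 *: (hinf_M gamma t.+1 *m invmx (hinf_Lambda gamma t) *m A
                 *m wc_state gamma x0 t).

Definition admissible_states : set 'cV[R]_n :=
  \bigcup_(gamma in [set gamma : R | gamma_low < gamma])
    [set x0 | seqnorm (wstar gamma x0) = 1].

Definition hinf_K (gamma : R) (t : nat) : 'M[R]_(m, n) :=
  invmx Rc *m B^T *m hinf_M gamma t.+1 *m invmx (hinf_Lambda gamma t) *m A.

Definition hinf_F (gamma : R) (t : nat) : 'M[R]_n := A - B *m hinf_K gamma t.

(* State trajectory under the feedback u_t = - K_t x_t. *)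
Fixpoint hinf_state (gamma : R) (w : nat -> 'cV[R]_n) (x0 : 'cV[R]_n)
    (t : nat) : 'cV[R]_n :=
  if t is t'.+1
  then A *m hinf_state gamma w x0 t'
       + B *m (- (hinf_K gamma t' *m hinf_state gamma w x0 t')) + w t'
  else x0.

Definition hinf_u (gamma : R) (w : nat -> 'cV[R]_n) (x0 : 'cV[R]_n)
    (t : nat) : 'cV[R]_m := - (hinf_K gamma t *m hinf_state gamma w x0 t).

(* A minimizer over all input sequences, chosen knowing w; the default 0 is
   only taken if there is none. Minimizers differ at most at irrelevant times
   t >= T when Q, QT are psd and R is positive definite. *)
Definition offline_u (w : nat -> 'cV[R]_n) (x0 : 'cV[R]_n) : nat -> 'cV[R]_m :=
  xget (fun=> 0) [set u | forall v, cost u w x0 <= cost v w x0].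

Definition hinf_regret (gamma : R) (w : nat -> 'cV[R]_n) (x0 : 'cV[R]_n) : R :=
  cost (hinf_u gamma w x0) w x0 - cost (offline_u w x0) w x0.

Definition hinf_P (gamma : R) : nat -> 'M[R]_n :=
  backward (fun t P => (hinf_F gamma t)^T *m P *m hinf_F gamma t + Q
                       + (hinf_K gamma t)^T *m Rc *m hinf_K gamma t) T QT.

Definition lqr_P : nat -> 'M[R]_n :=
  backward (fun _ P => Q + A^T *m P *m A
    - A^T *m P *m B *m invmx (Rc + B^T *m P *m B) *m B^T *m P *m A) T QT.

End LQControl.

(* Main.v *)
Require Import Defs.
From mathcomp Require Import all_boot all_order all_algebra.
From mathcomp Require Import all_classical all_reals.
From mathcomp Require Import zify ring lra.

Import Order.TTheory GRing.Theory Num.Theory.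

Local Open Scope ring_scope.
Set Implicit Arguments.
Unset Strict Implicit.
Unset Printing Implicit Defensive.

(** Along the worst-case disturbance w^*, the H-infinity inputs satisfy the
    first-order conditions of the offline problem with costate M_t x_t, so they
    are offline optimal and the regret vanishes at w^*. Around that pair the
    terms linear in D = w - w^* depend on D only, hence cancel in the regret,
    which is therefore at most the closed-loop cost J(u^oo, D; 0) started at 0.
    Since P^oo_t contracts at rate eta along F^oo_t, this cost is at most
    p (1 + 2 eta (1 - eta^T) / (1 - eta)) |D|^2, and |D| <= 2 absorbs it into
    the linear term k_1 |D|.

    The recursion makes sense for every gamma above the infimum gamma_low
    because M_t(gamma) is a min-max value, hence antitone in gamma, which makes
    the set of feasible gamma upward closed (and nonempty). *)

(** * Quadratic forms and spectral bounds *)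

Section DotProduct.
Context {R : realType}.

Definition dot n (x y : 'cV[R]_n) : R := (x^T *m y) 0 0.

Lemma dotC n (x y : 'cV[R]_n) : dot x y = dot y x.
Proof. by rewrite /dot -[in LHS](trmxK y) -trmx_mul mxE. Qed.

Lemma dotDr n (x y z : 'cV[R]_n) : dot x (y + z) = dot x y + dot x z.
Proof. by rewrite /dot mulmxDr mxE. Qed.

Lemma dotDl n (x y z : 'cV[R]_n) : dot (x + y) z = dot x z + dot y z.
Proof. by rewrite dotC dotDr !(dotC z). Qed.

Lemma dotZr n a (x y : 'cV[R]_n) : dot x (a *: y) = a * dot x y.
Proof. by rewrite /dot -scalemxAr mxE. Qed.

Lemma dotZl n a (x y : 'cV[R]_n) : dot (a *: x) y = a * dot x y.
Proof. by rewrite dotC dotZr dotC. Qed.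

Lemma dotNr n (x y : 'cV[R]_n) : dot x (- y) = - dot x y.
Proof. by rewrite -scaleN1r dotZr mulN1r. Qed.

Lemma dotNl n (x y : 'cV[R]_n) : dot (- x) y = - dot x y.
Proof. by rewrite dotC dotNr dotC. Qed.

Lemma dot0r n (x : 'cV[R]_n) : dot x 0 = 0.
Proof. by rewrite /dot mulmx0 mxE. Qed.

Lemma dot0l n (x : 'cV[R]_n) : dot 0 x = 0.
Proof. by rewrite dotC dot0r. Qed.

Lemma dot_mull n m (M : 'M[R]_(m, n)) (x : 'cV[R]_n) (y : 'cV[R]_m) :
  dot (M *m x) y = dot x (M^T *m y).
Proof. by rewrite /dot trmx_mul mulmxA. Qed.

Lemma dot_sym n (M : 'M[R]_n) (x y : 'cV[R]_n) : M^T = M ->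
  dot x (M *m y) = dot (M *m x) y.
Proof. by move=> sM; rewrite dot_mull sM. Qed.

Lemma dotxxE n (x : 'cV[R]_n) : dot x x = \sum_i x i 0 ^+ 2.
Proof. by rewrite /dot mxE; apply: eq_bigr => i _; rewrite mxE expr2. Qed.

Lemma dotxx_ge0 n (x : 'cV[R]_n) : 0 <= dot x x.
Proof. by rewrite dotxxE sumr_ge0 // => i _; rewrite sqr_ge0. Qed.

Lemma dotxx_eq0 n (x : 'cV[R]_n) : (dot x x == 0) = (x == 0).
Proof.
apply/idP/eqP => [|->]; last by rewrite dot0r.
rewrite dotxxE psumr_eq0 => [/allP x0|i _]; last exact: sqr_ge0.
apply/matrixP => i j; rewrite ord1 mxE; apply/eqP.
by rewrite -sqrf_eq0; apply: x0; rewrite mem_index_enum.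
Qed.

Lemma dotxx_gt0 n (x : 'cV[R]_n) : (0 < dot x x) = (x != 0).
Proof. by rewrite lt_neqAle dotxx_ge0 andbT eq_sym dotxx_eq0. Qed.

(** Supplies a nonzero vector in positive dimension, so that Rayleigh quotients exist. *)
Lemma const1_neq0 n : const_mx 1 != 0 :> 'cV[R]_n.+1.
Proof. by apply/eqP => /matrixP/(_ 0 0)/eqP; rewrite !mxE oner_eq0. Qed.

Lemma vnorm_ge0 n (x : 'cV[R]_n) : 0 <= vnorm x.
Proof. exact: sqrtr_ge0. Qed.

Lemma vnorm_sqr n (x : 'cV[R]_n) : vnorm x ^+ 2 = dot x x.
Proof. by rewrite /vnorm -dotxxE sqr_sqrtr // dotxx_ge0. Qed.

Lemma vnorm0 n : vnorm (0 : 'cV[R]_n) = 0.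
Proof. by rewrite /vnorm -dotxxE dot0r sqrtr0. Qed.

Lemma qformE n (M : 'M[R]_n) (x : 'cV[R]_n) : qform M x = dot x (M *m x).
Proof. by rewrite /qform /dot mulmxA. Qed.

Lemma qformDm n (M N : 'M[R]_n) (x : 'cV[R]_n) :
  qform (M + N) x = qform M x + qform N x.
Proof. by rewrite !qformE mulmxDl dotDr. Qed.

Lemma qformBm n (M N : 'M[R]_n) (x : 'cV[R]_n) :
  qform (M - N) x = qform M x - qform N x.
Proof. by rewrite !qformE mulmxBl dotDr dotNr. Qed.

Lemma psd_qform_le n (M N : 'M[R]_n) (x : 'cV[R]_n) :
  psd (M - N) -> qform N x <= qform M x.
Proof. by case=> _ /(_ x); rewrite qformBm subr_ge0. Qed.

Lemma qformD n (M : 'M[R]_n) (x y : 'cV[R]_n) : M^T = M ->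
  qform M (x + y) = qform M x + 2 * dot x (M *m y) + qform M y.
Proof.
move=> sM; rewrite !qformE mulmxDr !dotDl !dotDr.
rewrite [dot y (M *m x)]dotC dot_mull sM; ring.
Qed.

Lemma qformZ n (M : 'M[R]_n) a (x : 'cV[R]_n) :
  qform M (a *: x) = a ^+ 2 * qform M x.
Proof. by rewrite !qformE -scalemxAr dotZl dotZr mulrA expr2. Qed.

Lemma qform0 n (M : 'M[R]_n) : qform M 0 = 0.
Proof. by rewrite qformE dot0l. Qed.

Lemma qform_scalar n a (x : 'cV[R]_n) : qform a%:M x = a * dot x x.
Proof. by rewrite qformE mul_scalar_mx dotZr. Qed.

Lemma qform_congr n m (M : 'M[R]_n) (A : 'M[R]_(n, m)) (x : 'cV[R]_m) :
  qform (A^T *m M *m A) x = qform M (A *m x).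
Proof. by rewrite !qformE dot_mull !mulmxA. Qed.

Lemma psd1 n : psd (1%:M : 'M[R]_n).
Proof. by split=> [|x]; rewrite ?trmx1 // qform_scalar mul1r dotxx_ge0. Qed.

Lemma posdef_psd n (M : 'M[R]_n) : posdef M -> psd M.
Proof.
case=> sM pM; split=> // x; have [->|/pM/ltW//] := eqVneq x 0.
by rewrite qform0.
Qed.

Lemma psdD n (M N : 'M[R]_n) : psd M -> psd N -> psd (M + N).
Proof.
case=> sM pM [sN pN]; split=> [|x]; first by rewrite linearD /= sM sN.
by rewrite qformDm addr_ge0.
Qed.

Lemma psd_congr n m (M : 'M[R]_n) (A : 'M[R]_(n, m)) :
  psd M -> psd (A^T *m M *m A).
Proof.
case=> sM pM; split=> [|x]; last by rewrite qform_congr.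
by rewrite !trmx_mul trmxK sM mulmxA.
Qed.

(** The quadratic [qform M (x + s *: y)] in [s] is nonnegative, which forces its discriminant to be
    nonpositive. *)
Lemma psd_cauchy_schwarz n (M : 'M[R]_n) (x y : 'cV[R]_n) : psd M ->
  dot x (M *m y) ^+ 2 <= qform M x * qform M y.
Proof.
case=> sM pM; set b := dot _ _.
have key s : 0 <= qform M x + 2 * s * b + s ^+ 2 * qform M y.
  have := pM (x + s *: y); rewrite qformD // -scalemxAr dotZr qformZ.
  by rewrite -/b mulrA.
have [y0|yN0] := eqVneq (qform M y) 0.
  rewrite y0 mulr0; have [->|bN0] := eqVneq b 0; first by rewrite expr0n.
  (* The quadratic degenerates to an affine function of [s]; this [s] would give it the value -1. *)
  have := key (- (qform M x + 1) / (2 * b)); rewrite y0 mulr0 addr0.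
  have -> : 2 * (- (qform M x + 1) / (2 * b)) * b = - (qform M x + 1) by field.
  by rewrite opprD addrA subrr add0r ler0N1.
have y_gt0 : 0 < qform M y by rewrite lt_neqAle eq_sym yN0 pM.
(* The minimizer in [s]. *)
have := key (- b / qform M y).
have -> : qform M x + 2 * (- b / qform M y) * b +
  (- b / qform M y) ^+ 2 * qform M y = (qform M x * qform M y - b ^+ 2) / qform M y.
  by field.
by rewrite pmulr_lge0 ?invr_gt0 // subr_ge0.
Qed.

(** Cauchy-Schwarz for the pair [M *m x], [x] bounds [|M x|^4] by a multiple of [qform M x]. *)
Lemma psd_qform_eq0 n (M : 'M[R]_n) (x : 'cV[R]_n) : psd M ->
  qform M x <= 0 -> M *m x = 0.
Proof.
move=> pM x_le0; apply/eqP; rewrite -dotxx_eq0 -sqrf_eq0.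
rewrite eq_le sqr_ge0 andbT; apply: le_trans (psd_cauchy_schwarz _ _ pM) _.
by rewrite mulr_ge0_le0 // pM.2.
Qed.

Lemma cauchy_schwarz n (x y : 'cV[R]_n) : dot x y ^+ 2 <= dot x x * dot y y.
Proof.
have := psd_cauchy_schwarz x y (psd1 n).
by rewrite mul1mx !qform_scalar !mul1r.
Qed.

Lemma dot_le_vnorm n (x y : 'cV[R]_n) : dot x y <= vnorm x * vnorm y.
Proof.
apply: le_trans (ler_norm _) _.
rewrite -(ler_pXn2r (ltn0Sn 1)) ?nnegrE ?mulr_ge0 ?vnorm_ge0 //.
by rewrite real_normK ?num_real // exprMn !vnorm_sqr cauchy_schwarz.
Qed.

Lemma vnormZ n a (x : 'cV[R]_n) : vnorm (a *: x) = `|a| * vnorm x.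
Proof.
apply/eqP; rewrite -(eqrXn2 (ltn0Sn 1)) ?mulr_ge0 ?vnorm_ge0 //.
by rewrite exprMn !vnorm_sqr dotZl dotZr real_normK ?num_real // expr2 mulrA.
Qed.

(** Cauchy-Schwarz on each row; the constant is the squared Frobenius norm, plus 1 to make it
    positive. *)
Lemma mulmx_dot_bound m n (M : 'M[R]_(m, n)) :
  exists2 c : R, 0 < c & forall x, dot (M *m x) (M *m x) <= c * dot x x.
Proof.
pose r i : 'cV[R]_n := (row i M)^T.
have r_ge0 : 0 <= \sum_i dot (r i) (r i) by rewrite sumr_ge0 // => i _; exact: dotxx_ge0.
exists (1 + \sum_i dot (r i) (r i)) => [|x]; first by rewrite ltr_wpDr.
rewrite mulrDl mul1r mulr_suml ler_wpDl ?dotxx_ge0 // [leLHS]dotxxE.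
apply: ler_sum => i _; apply: le_trans (cauchy_schwarz _ _).
rewrite /r /dot trmxK !mxE le_eqVlt; apply/orP; left; apply/eqP.
by congr (_ ^+ 2); apply: eq_bigr => j _; rewrite !mxE.
Qed.

Lemma qform_bound n (M : 'M[R]_n) :
  exists2 c : R, 0 < c & forall x, `|qform M x| <= c * dot x x.
Proof.
have [c c0 Mc] := mulmx_dot_bound M.
exists (1 + c) => [|x]; first by rewrite addr_gt0.
rewrite qformE -(ler_pXn2r (ltn0Sn 1)) ?nnegrE ?mulr_ge0 ?dotxx_ge0 //; last by lra.
rewrite real_normK ?num_real //; apply: le_trans (cauchy_schwarz _ _) _.
have /= := Mc x; have := dotxx_ge0 x; nra.
Qed.

Lemma unitmx_ker0 n (M : 'M[R]_n) :
  (forall x : 'cV[R]_n, M *m x = 0 -> x = 0) -> M \in unitmx.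
Proof.
move=> ker0; rewrite -unitmx_tr -row_free_unit -kermx_eq0.
apply/rowV0P => v /sub_kermxP vM; apply: trmx_inj; rewrite trmx0; apply: ker0.
by rewrite -[LHS]trmxK trmx_mul trmxK vM trmx0.
Qed.

Lemma posdef_unitmx n (M : 'M[R]_n) : posdef M -> M \in unitmx.
Proof.
case=> sM pM; apply: unitmx_ker0 => x Mx; apply/eqP/negPn/negP => /pM.
by rewrite qformE Mx dot0r ltxx.
Qed.

(* With mu the infimum of the Rayleigh quotient, N = M - mu is psd; were it
   invertible, |x|^2 <= c |N x|^2 <= c c' qform N x would push the infimum
   strictly above mu. *)
Lemma sym_min_eigenvalue n (M : 'M[R]_n.+1) : M^T = M ->
  exists2 mu, eigenvalue M mu & forall x : 'cV[R]_n.+1, mu * dot x x <= qform M x.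
Proof.
move=> sM; pose E := [set a | exists2 x : 'cV[R]_n.+1, x != 0 &
  a = qform M x / dot x x]%classic.
have [c c0 Mc] := qform_bound M.
have hE : has_inf E.
  split.
    pose x1 : 'cV[R]_n.+1 := const_mx 1.
    by exists (qform M x1 / dot x1 x1), x1 => //; exact: const1_neq0.
  exists (- c) => a [x x0 ->]; rewrite ler_pdivlMr ?dotxx_gt0 // mulNr.
  by have := Mc x; rewrite ler_norml => /andP[].
have muP x : inf E * dot x x <= qform M x.
  have [->|x0] := eqVneq x 0; first by rewrite dot0r mulr0 qform0.
  rewrite -ler_pdivlMr ?dotxx_gt0 //; apply: inf_lbound; first by case: hE.
  by exists x.
exists (inf E) => //; set mu := inf E.
pose N := M - mu%:M; have NE x : qform N x = qform M x - mu * dot x x.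
  by rewrite qformBm qform_scalar.
have pN : psd N.
  split=> [|x]; first by rewrite /N linearB /= sM tr_scalar_mx.
  by rewrite NE subr_ge0.
rewrite /eigenvalue /eigenspace kermx_eq0 row_free_unit -/N; apply/negP => uN.
have [c1 c10 c1P] := mulmx_dot_bound (invmx N).
have [c2 c20 c2P] := qform_bound N.
have lb x : dot x x <= c1 * c2 * qform N x.
  apply: le_trans (_ : _ <= c1 * dot (N *m x) (N *m x)) _.
    by have := c1P (N *m x); rewrite mulKmx.
  rewrite -mulrA ler_pM2l //; have [->|Nx0] := eqVneq (N *m x) 0.
    by rewrite dot0r mulr_ge0 ?pN.2 ?ltW.
  have dN : 0 < dot (N *m x) (N *m x) by rewrite dotxx_gt0.
  have := psd_cauchy_schwarz (N *m x) x pN.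
  have := le_trans (ler_norm _) (c2P (N *m x)); have := pN.2 x.
  move: dN; move: (dot _ _) (qform N _) (qform N _) => a b q; nra.
have : mu + (c1 * c2)^-1 <= mu.
  apply: lb_le_inf; first by case: hE.
  move=> a [x x0 ->]; rewrite ler_pdivlMr ?dotxx_gt0 // mulrDl.
  have := lb x; rewrite -ler_pdivrMl ?mulr_gt0 // NE; lra.
by rewrite gerDl leNgt invr_gt0 mulr_gt0.
Qed.

Lemma eigenvalueN n (M : 'M[R]_n) a : eigenvalue M a -> eigenvalue (- M) (- a).
Proof.
move=> /eigenvalueP[v vM v0]; apply/eigenvalueP; exists v => //.
by rewrite mulmxN vM scaleNr.
Qed.

Lemma eigenvalue_colP n (M : 'M[R]_n) a : M^T = M -> eigenvalue M a ->
  exists2 x : 'cV[R]_n, x != 0 & qform M x = a * dot x x.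
Proof.
move=> sM /eigenvalueP[v vM v0]; exists v^T.
  by apply: contraNneq v0 => v0; rewrite -[v]trmxK v0 trmx0.
by rewrite qformE -{1}sM -trmx_mul vM linearZ /= dotZr.
Qed.

(** Every eigenvalue is a Rayleigh quotient, so the set of eigenvalues is bounded below and its
    infimum is at most the eigenvalue [mu], itself a lower bound for all quotients. *)
Lemma lambda_min_qform n (M : 'M[R]_n.+1) x : M^T = M ->
  lambda_min M * dot x x <= qform M x.
Proof.
move=> sM; have [mu emu muP] := sym_min_eigenvalue sM.
apply: le_trans (muP x); rewrite ler_wpM2r ?dotxx_ge0 //.
apply: inf_lbound => //; exists mu => a /= /(eigenvalue_colP sM)[y y0 ay].
by have := muP y; rewrite ay ler_pM2r ?dotxx_gt0.
Qed.

(** The least eigenvalue of [- M], with its sign reversed, is the largest one of [M]. *)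
Lemma lambda_max_qform n (M : 'M[R]_n.+1) x : M^T = M ->
  qform M x <= lambda_max M * dot x x.
Proof.
move=> sM; have sNM : (- M)^T = - M by rewrite linearN /= sM.
have [mu emu muP] := sym_min_eigenvalue sNM.
have NMP y : mu * dot y y <= - qform M y.
  by apply: le_trans (muP y) _; rewrite !qformE mulNmx dotNr.
apply: le_trans (_ : - mu * dot x x <= _); first by have := NMP x; lra.
rewrite ler_wpM2r ?dotxx_ge0 //; apply: sup_ubound; last first.
  by rewrite /= -[M]opprK; exact: eigenvalueN.
exists (- mu) => a /= /(eigenvalue_colP sM)[y y0 ay].
by have := NMP y; rewrite ay -mulNr ler_pM2r ?dotxx_gt0 //; lra.
Qed.

Lemma spectral_norm_ubound m n (M : 'M[R]_(m, n)) :
  has_ubound [set vnorm (M *m x) | x in [set x : 'cV[R]_n | vnorm x <= 1]]%classic.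
Proof.
have [c c0 cP] := mulmx_dot_bound M; exists (1 + c) => _ [x /= x1 <-].
rewrite -(ler_pXn2r (ltn0Sn 1)) ?nnegrE ?vnorm_ge0 //; last by lra.
rewrite vnorm_sqr; apply: le_trans (cP x) _.
have : dot x x <= 1 by rewrite -vnorm_sqr expr_le1 ?vnorm_ge0.
nra.
Qed.

Lemma spectral_norm_ge0 m n (M : 'M[R]_(m, n)) : 0 <= spectral_norm M.
Proof.
apply: (@le_trans _ _ (vnorm (M *m 0))); first exact: vnorm_ge0.
apply: sup_ubound; first exact: spectral_norm_ubound.
by exists 0; rewrite /= ?vnorm0 ?ler01.
Qed.

Lemma vnorm_mulmx_le m n (M : 'M[R]_(m, n)) x :
  vnorm (M *m x) <= spectral_norm M * vnorm x.
Proof.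
have [->|x0] := eqVneq x 0.
  by rewrite mulmx0 !vnorm0 mulr0.
have nx : 0 < vnorm x by rewrite /vnorm -dotxxE sqrtr_gt0 dotxx_gt0.
rewrite -ler_pdivrMr //; apply: sup_ubound; first exact: spectral_norm_ubound.
exists ((vnorm x)^-1 *: x) => /=.
  by rewrite vnormZ gtr0_norm ?invr_gt0 // mulVf ?gt_eqF.
by rewrite -scalemxAr vnormZ gtr0_norm ?invr_gt0 // mulrC.
Qed.

Lemma qform_le_spectral_norm n (M : 'M[R]_n) x :
  qform M x <= spectral_norm M * dot x x.
Proof.
rewrite qformE -vnorm_sqr; apply: le_trans (dot_le_vnorm _ _) _.
by rewrite expr2 mulrCA ler_wpM2l ?vnorm_ge0 // vnorm_mulmx_le.
Qed.

End DotProduct.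

(** * The Riccati step as a min-max value *)

Section RiccatiStep.
Context {R : realType} {n m : nat}.
Variables (S : lq_problem R n m).

Local Notation A := (dynA S).
Local Notation B := (dynB S).
Local Notation Rc := (costR S).

Hypothesis HR : posdef Rc.

Lemma psd_input_gramian : psd (B *m invmx Rc *m B^T).
Proof.
have uR := posdef_unitmx HR; have [sR _] := HR.
have pV : psd (invmx Rc).
  have -> : invmx Rc = (invmx Rc)^T *m Rc *m invmx Rc.
    by rewrite trmx_inv sR mulVmx // mul1mx.
  by apply: psd_congr; exact: posdef_psd.
by have := psd_congr B^T pV; rewrite trmxK.
Qed.

(** * Minimization of [qform N (x + B u) + qform Rc u] over the input [u] *)

Section MinOverInput.
Variable N : 'M[R]_n.
Hypothesis HN : psd N.

(** With [G = B R^-1 B^T], [Z = N (I + G N)^-1] is the matrix of the minimal value; it equals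
    [(N^-1 + G)^-1] when [N] is invertible. *)
Local Notation Lam := (1%:M + B *m invmx Rc *m B^T *m N).
Local Notation Z := (N *m invmx Lam).

(** If [y = - G N y], then [qform N y = - qform G (N y) <= 0], so [N y = 0] and hence [y = 0]. *)
Lemma min_input_unitmx : Lam \in unitmx.
Proof.
apply: unitmx_ker0 => y; rewrite mulmxDl mul1mx -mulmxA => /eqP.
rewrite addr_eq0 => /eqP yE; have [sN pN] := HN.
have Ny : N *m y = 0.
  apply: psd_qform_eq0 HN _.
  rewrite qformE {1}yE dotNl dot_mull psd_input_gramian.1.
  by rewrite -qformE oppr_le0 psd_input_gramian.2.
by rewrite yE Ny mulmx0 oppr0.
Qed.

(** Both [Lam^T N] and [N Lam] equal [N + N G N]; cancel [Lam] on either side. *)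
Lemma min_input_tr : Z^T = Z.
Proof.
have uL := min_input_unitmx; have [sN pN] := HN.
have [sG _] := psd_input_gramian.
have LN : Lam^T *m N = N *m Lam.
  by rewrite linearD /= trmx1 trmx_mul sG sN mulmxDl mulmxDr mul1mx mulmx1 !mulmxA.
rewrite trmx_mul trmx_inv sN; apply: (can_inj (mulKmx (_ : Lam^T \in unitmx))).
  by rewrite unitmx_tr.
by rewrite mulKVmx ?unitmx_tr // mulmxA LN mulmxK.
Qed.

Local Notation opt x := (- (invmx Rc *m B^T *m (Z *m x))).

(* Completing the square; x + B u reduces to y = Lam^-1 x at the optimum. *)
Lemma min_input_square x v :
  qform N (x + B *m (opt x + v)) + qform Rc (opt x + v) =
  qform Z x + (qform N (B *m v) + qform Rc v).
Proof.
have uL := min_input_unitmx; have [sN pN] := HN.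
have uR := posdef_unitmx HR; have [sR _] := HR.
have [sG _] := psd_input_gramian.
pose y := invmx Lam *m x; pose u := opt x; rewrite -/u.
have ZE : Z *m x = N *m y by rewrite -mulmxA.
have xE : x = y + B *m invmx Rc *m B^T *m (N *m y).
  have {1}-> : x = Lam *m y by rewrite mulKVmx.
  by rewrite mulmxDl mul1mx !mulmxA.
have BuE : x + B *m u = y.
  by rewrite /u ZE {1}xE mulmxN !mulmxA addrK.
rewrite mulmxDr addrA BuE !qformD //.
(* Stationarity in the input: this makes the terms linear in [v] cancel. *)
have RuE : Rc *m u = - (B^T *m (N *m y)).
  by rewrite /u ZE mulmxN !mulmxA mulmxV // mul1mx.
have -> : dot u (Rc *m v) = - dot y (N *m (B *m v)).
  by rewrite dotC dot_mull sR RuE dotNr -dot_mull dotC dot_mull sN.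
suff <- : qform N y + qform Rc u = qform Z x by ring.
rewrite !qformE RuE ZE {1}xE dotDl; congr (_ + _).
by rewrite /u ZE dotNl dotNr opprK -!mulmxA dot_mull.
Qed.

Lemma min_input_le x u : qform Z x <= qform N (x + B *m u) + qform Rc u.
Proof.
have := min_input_square x (u - opt x); rewrite (addrC (opt x)) subrK => ->.
by rewrite lerDl addr_ge0 ?HN.2 ?(posdef_psd HR).2.
Qed.

Lemma min_input_attained x :
  qform Z x = qform N (x + B *m opt x) + qform Rc (opt x).
Proof.
by have := min_input_square x 0; rewrite addr0 mulmx0 !qform0 !addr0 => ->.
Qed.

End MinOverInput.

Lemma min_input_psd N : psd N ->
  psd (N *m invmx (1%:M + B *m invmx Rc *m B^T *m N)).
Proof.
move=> pN; split=> [|x]; first exact: min_input_tr.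
by rewrite min_input_attained // addr_ge0 ?pN.2 ?(posdef_psd HR).2.
Qed.

(** * Maximization of [qform M (x + w) - g |w|^2] over the disturbance [w] *)

Section MaxOverDisturbance.
Variables (g : R) (M : 'M[R]_n).
Hypotheses (Hg : 0 < g) (HM : psd M) (HgM : posdef (g%:M - M)).

Local Notation D := (1%:M - g^-1 *: M).
Local Notation N := (M *m invmx D).

Lemma max_dist_unitmx : D \in unitmx.
Proof.
have -> : D = g^-1 *: (g%:M - M).
  by rewrite scalerBr scale_scalar_mx mulVf ?gt_eqF.
by rewrite unitmxZ ?posdef_unitmx // unitfE invr_eq0 gt_eqF.
Qed.

Lemma max_dist_tr : N^T = N.
Proof.
have uD := max_dist_unitmx; have [sM _] := HM.
have DT : D^T = D by rewrite linearB linearZ /= trmx1 sM.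
rewrite trmx_mul trmx_inv sM DT; apply: (can_inj (mulKmx uD)).
rewrite mulKVmx // mulmxA; have -> : D *m M = M *m D.
  by rewrite mulmxBl mulmxBr mul1mx mulmx1 -scalemxAl -scalemxAr.
by rewrite mulmxK.
Qed.

(** Completing the square at the maximizer [g^-1 N x], which moves [x] to [y = D^-1 x]; the
    remaining form [g I - M] is positive definite. *)
Lemma max_dist_square x v :
  qform M (x + (g^-1 *: (N *m x) + v))
    - g * dot (g^-1 *: (N *m x) + v) (g^-1 *: (N *m x) + v) =
  qform N x - qform (g%:M - M) v.
Proof.
have uD := max_dist_unitmx; have [sM _] := HM; have g0 := gt_eqF Hg.
pose y := invmx D *m x; have NE : N *m x = M *m y by rewrite -mulmxA.
have xE : x = y - g^-1 *: (M *m y).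
  have {1}-> : x = D *m y by rewrite mulKVmx.
  by rewrite mulmxBl mul1mx scalemxAl.
rewrite NE addrA {1}xE subrK qformD // qformBm qform_scalar.
rewrite qformE [qform N x]qformE NE {1}xE.
rewrite !dotDl !dotDr !dotNl !dotZl !dotZr (dotC v) [dot y (M *m v)]dotC.
rewrite dot_mull sM (dotC v) [dot (M *m y) v]dotC.
by field; rewrite g0.
Qed.

Lemma max_dist_ge x w : qform M (x + w) - g * dot w w <= qform N x.
Proof.
have := max_dist_square x (w - g^-1 *: (N *m x)).
rewrite [_ *: _ + (_ - _)]addrC subrK => ->.
by rewrite gerBl (posdef_psd HgM).2.
Qed.

Lemma max_dist_attained x : qform N x =
  qform M (x + g^-1 *: (N *m x)) - g * dot (g^-1 *: (N *m x)) (g^-1 *: (N *m x)).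
Proof. by have := max_dist_square x 0; rewrite addr0 qform0 subr0. Qed.

Lemma max_dist_psd : psd N.
Proof.
split=> [|x]; first exact: max_dist_tr.
by apply: le_trans (max_dist_ge x 0); rewrite addr0 dot0l mulr0 subr0 HM.2.
Qed.

End MaxOverDisturbance.

Local Notation Lam gamma M := (hinf_Lambda_of S gamma M).

Section HinfStep.
Variables (gamma : R) (M : 'M[R]_n).
Hypotheses (Hg : 0 < gamma) (HM : psd M).
Hypothesis HgM : posdef ((gamma ^+ 2)%:M - M).

Local Notation D := (1%:M - gamma ^- 2 *: M).
Local Notation N := (M *m invmx D).

(** Since [N D = M], the matrix splits into the disturbance factor [D] and the input factor built on
    [N]. *)
Lemma hinf_Lambda_factor :
  Lam gamma M = (1%:M + B *m invmx Rc *m B^T *m N) *m D.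
Proof.
have uD := max_dist_unitmx (exprn_gt0 2 Hg) HgM.
rewrite /hinf_Lambda_of [RHS]mulmxDl mul1mx mulmxBl mul_scalar_mx.
by rewrite -[X in _ = _ + X]mulmxA mulmxKV // addrA addrAC.
Qed.

Lemma hinf_Lambda_unitmx : Lam gamma M \in unitmx.
Proof.
have uD := max_dist_unitmx (exprn_gt0 2 Hg) HgM.
have pN := max_dist_psd (exprn_gt0 2 Hg) HM HgM.
by rewrite hinf_Lambda_factor unitmx_mul uD andbT min_input_unitmx.
Qed.

(** Identifies the Riccati step with two nested optimizations: the maximum over [w] turns [M] into
    [N], then the minimum over [u] is taken for [N]. *)
Lemma hinf_gain_factor : M *m invmx (Lam gamma M) =
  N *m invmx (1%:M + B *m invmx Rc *m B^T *m N).
Proof.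
have uD := max_dist_unitmx (exprn_gt0 2 Hg) HgM.
have pN := max_dist_psd (exprn_gt0 2 Hg) HM HgM.
have uL := min_input_unitmx pN.
apply: (can_inj (mulmxK hinf_Lambda_unitmx)); rewrite mulmxKV ?hinf_Lambda_unitmx //.
rewrite hinf_Lambda_factor; set L := _ + _ in uL *.
by rewrite [RHS]mulmxA (mulmxKV uL) mulmxKV.
Qed.

Lemma hinf_gain_psd : psd (M *m invmx (Lam gamma M)).
Proof.
rewrite hinf_gain_factor; apply: min_input_psd.
exact: max_dist_psd (exprn_gt0 2 Hg) HM HgM.
Qed.

End HinfStep.

(* Both sides are min-max values, monotone in M and antitone in gamma. *)
Lemma hinf_gain_mono g1 g2 (M1 M2 : 'M[R]_n) : 0 < g1 -> g1 <= g2 ->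
  psd M1 -> psd M2 -> psd (M1 - M2) ->
  posdef ((g1 ^+ 2)%:M - M1) -> posdef ((g2 ^+ 2)%:M - M2) ->
  psd (M1 *m invmx (Lam g1 M1) - M2 *m invmx (Lam g2 M2)).
Proof.
move=> g1_gt0 g12 pM1 pM2 pM12 pD1 pD2; have g2_gt0 := lt_le_trans g1_gt0 g12.
have [s1 _] := hinf_gain_psd g1_gt0 pM1 pD1.
have [s2 _] := hinf_gain_psd g2_gt0 pM2 pD2.
split=> [|x]; first by rewrite linearB /= s1 s2.
have q1 := exprn_gt0 2 g1_gt0; have q2 := exprn_gt0 2 g2_gt0.
rewrite qformBm subr_ge0 !hinf_gain_factor //.
rewrite [leRHS]min_input_attained; last exact: max_dist_psd.
(* [u] is optimal for [M1] and serves as a candidate for [M2]; next, the worst disturbance for [M2]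
   serves as a candidate for [M1]. *)
move: (- (invmx Rc *m B^T *m _)) => u.
apply: le_trans (min_input_le _ x u) _; first exact: max_dist_psd.
rewrite lerD2r [leLHS]max_dist_attained //; apply: le_trans (max_dist_ge q1 pM1 pD1 _ _).
apply: lerB; first exact: psd_qform_le.
by rewrite ler_wpM2r ?dotxx_ge0 // ler_pXn2r ?nnegrE // ltW.
Qed.

End RiccatiStep.

(** * Feasible attenuation levels *)

Section HinfRecursion.
Context {R : realType} {n m : nat}.
Variables (S : lq_problem R n m) (T : nat).

Local Notation A := (dynA S).
Local Notation B := (dynB S).
Local Notation Q := (costQ S).
Local Notation QT := (costQT S).
Local Notation Rc := (costR S).
Local Notation M := (hinf_M S T).

Hypotheses (HQ : psd Q) (HQT : psd QT) (HR : posdef Rc).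

Lemma hinf_M_end gamma : M gamma T = QT.
Proof. exact: backward_end. Qed.

Lemma hinf_M_rec gamma t : (t < T)%N -> M gamma t =
  Q + A^T *m (M gamma t.+1 *m invmx (hinf_Lambda S T gamma t)) *m A.
Proof. by move=> tT; rewrite /hinf_M backward_rec // !mulmxA. Qed.

Local Notation feasible gamma t :=
  (posdef ((gamma ^+ 2)%:M - M gamma t.+1)).

Lemma posdef_sub_le g1 g2 (M1 M2 : 'M[R]_n) : 0 < g1 -> g1 <= g2 ->
  psd M2 -> psd (M1 - M2) ->
  posdef ((g1 ^+ 2)%:M - M1) -> posdef ((g2 ^+ 2)%:M - M2).
Proof.
move=> g1_gt0 g12 [s2 _] pM12 [_ pD1]; split=> [|x x0].
  by rewrite linearB /= tr_scalar_mx s2.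
apply: lt_le_trans (pD1 x x0) _; rewrite !qformBm !qform_scalar.
apply: lerB; last exact: psd_qform_le.
rewrite ler_wpM2r ?dotxx_ge0 // ler_pXn2r ?nnegrE ?(ltW g1_gt0) //.
exact: le_trans (ltW g1_gt0) g12.
Qed.

(** Backward induction on the last [k] steps. Feasibility is assumed for [g1] only; at each step the
    comparison already reached transfers it to [g2], which allows the next use of
    [hinf_gain_mono]. *)
Lemma hinf_M_mono g1 g2 k : 0 < g1 -> g1 <= g2 -> (k <= T)%N ->
  (forall t, (T - k <= t < T)%N -> feasible g1 t) ->
  [/\ psd (M g1 (T - k)), psd (M g2 (T - k)) & psd (M g1 (T - k) - M g2 (T - k))].
Proof.
move=> g1_gt0 g12; have g2_gt0 := lt_le_trans g1_gt0 g12.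
elim: k => [|k IHk] kT feas.
  rewrite subn0 !hinf_M_end subrr; split=> //; split=> [|x]; first by rewrite trmx0.
  by rewrite qformE mul0mx dot0r.
have Tk : (T - k.+1).+1 = (T - k)%N by rewrite subnSK.
have ltT : (T - k.+1 < T)%N by rewrite -Tk in IHk *; lia.
have [|t /andP[lt1 lt2]|p1 p2 p12] := IHk; first exact: ltnW.
  by apply: feas; rewrite lt2 andbT; apply: leq_trans lt1; rewrite -Tk.
have f1 : feasible g1 (T - k.+1) by apply: feas; rewrite leqnn.
have f2 : feasible g2 (T - k.+1).
  by move: f1; rewrite Tk; exact: posdef_sub_le.
rewrite !(hinf_M_rec _ ltT) /hinf_Lambda; rewrite Tk in f1 f2 *; clear IHk feas.
move: (M g1 _) (M g2 _) f1 f2 p1 p2 p12 => M1 M2 f1 f2 p1 p2 p12.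
have G1 := hinf_gain_psd HR g1_gt0 p1 f1; have G2 := hinf_gain_psd HR g2_gt0 p2 f2.
split.
- exact: psdD HQ (psd_congr _ G1).
- exact: psdD HQ (psd_congr _ G2).
- rewrite opprD addrACA subrr add0r -mulmxBl -mulmxBr; apply: psd_congr.
  exact: hinf_gain_mono.
Qed.

Lemma feasible_mono g1 g2 k t : 0 < g1 -> g1 <= g2 -> (k <= T)%N ->
  (forall t, (T - k <= t < T)%N -> feasible g1 t) ->
  (T - k <= t < T)%N -> feasible g2 t.
Proof.
move=> g1_gt0 g12 kT feas /andP[kt tT].
have tE : t.+1 = (T - (T - t.+1))%N by lia.
have [|||t' t't|p1 p2 p12] := @hinf_M_mono g1 g2 (T - t.+1) => //; first by lia.
  by apply: feas; lia.
have {kt tT} := feas t (introT andP (conj kt tT)); rewrite tE.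
exact: posdef_sub_le g1_gt0 g12 p2 p12.
Qed.

(** One step further back, raising the level keeps the later steps feasible and can only decrease
    the matrix at [T - k], while the squared level grows past a bound for it. *)
Lemma feasible_exists k : (k <= T)%N -> exists2 gamma, 0 < gamma &
  forall t, (T - k <= t < T)%N -> feasible gamma t.
Proof.
elim: k => [|k IHk] kT; first by exists 1 => // t; lia.
have [g g0 feas] := IHk (ltnW kT); have [c c0 cM] := qform_bound (M g (T - k)).
have gg' : g <= g + c + 1 by lra.
have [p1 p2 p12] := hinf_M_mono g0 gg' (ltnW kT) feas.
(* Chosen so that [(g + c + 1)^2 > c]. *)
exists (g + c + 1) => [|t tk]; first by lra.
have [tkE|tk'] := eqVneq t (T - k.+1)%N; last first.
  by apply: (feasible_mono g0 gg' (ltnW kT) feas); lia.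
rewrite tkE subnSK //; split=> [|x x0].
  by rewrite linearB /= tr_scalar_mx p2.1.
rewrite qformBm qform_scalar subr_gt0; apply: le_lt_trans (psd_qform_le _ p12) _.
apply: le_lt_trans (le_trans (ler_norm _) (cM x)) _.
rewrite ltr_pM2r ?dotxx_gt0 //; nra.
Qed.

(** A level above the infimum of a nonempty set exceeds some feasible level, and feasibility is
    upward closed. *)
Lemma gamma_low_feasible gamma : gamma_low S T < gamma ->
  0 < gamma /\ forall t, (t < T)%N -> feasible gamma t.
Proof.
move=> lt_gamma; have [g1 g1_gt0] := feasible_exists (leqnn T).
rewrite subnn => feas1; have [] := inf_lt _ lt_gamma.
  by exists g1; split.
move=> g2 [g2_gt0 feas2] /ltW g2g; split=> [|t tT].
  exact: lt_le_trans g2g.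
by apply: (feasible_mono g2_gt0 g2g (leqnn T)); rewrite subnn // => t' /feas2.
Qed.

Lemma hinf_Lambda_unit gamma t : gamma_low S T < gamma -> (t < T)%N ->
  hinf_Lambda S T gamma t \in unitmx.
Proof.
move=> /gamma_low_feasible[g0 feas] tT.
apply: hinf_Lambda_unitmx => //; last exact: feas.
(* Comparing [gamma] with itself yields that the matrix at [t.+1] is psd. *)
have [|||t' t't|+ _ _] := @hinf_M_mono gamma gamma (T - t.+1) => //; first by lia.
  by apply: feas; lia.
by rewrite subKn.
Qed.

End HinfRecursion.

(** * Regret against the worst-case disturbance *)

Section Regret.
Context {R : realType} {n m : nat}.
Variables (S : lq_problem R n m) (T : nat).

Local Notation A := (dynA S).
Local Notation B := (dynB S).
Local Notation Q := (costQ S).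
Local Notation QT := (costQT S).
Local Notation Rc := (costR S).
Local Notation M := (hinf_M S T).

Hypotheses (HQ : psd Q) (HQT : psd QT) (HR : posdef Rc).

Lemma stateD u v w z x y t :
  state S (fun k => u k + v k) (fun k => w k + z k) (x + y) t =
  state S u w x t + state S v z y t.
Proof.
by elim: t => //= t ->; rewrite !mulmxDr [RHS]addrACA [X in _ = X + _]addrACA.
Qed.

Lemma hinf_stateD gamma w z x y t :
  hinf_state S T gamma (fun k => w k + z k) (x + y) t =
  hinf_state S T gamma w x t + hinf_state S T gamma z y t.
Proof.
elim: t => //= t ->.
by rewrite !mulmxDr opprD mulmxDr [RHS]addrACA [X in _ = X + _]addrACA.
Qed.

Lemma state_hinf_u gamma w x t :
  state S (hinf_u S T gamma w x) w x t = hinf_state S T gamma w x t.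
Proof. by elim: t => //= t ->. Qed.

(** The polar form of the cost, which is quadratic jointly in inputs, disturbances and initial
    state. *)
Definition cost_bilin u w x v z y : R :=
  dot (state S u w x T) (QT *m state S v z y T)
  + \sum_(t < T) (dot (state S u w x t) (Q *m state S v z y t)
                  + dot (u t) (Rc *m v t)).

Lemma costD u v w z x y :
  cost S T (fun k => u k + v k) (fun k => w k + z k) (x + y) =
  cost S T u w x + 2 * cost_bilin u w x v z y + cost S T v z y.
Proof.
rewrite /cost /cost_bilin stateD (qformD _ _ HQT.1).
rewrite (eq_bigr (fun t : 'I_T => (qform Q (state S u w x t) + qform Rc (u t)) +
  2 * (dot (state S u w x t) (Q *m state S v z y t) + dot (u t) (Rc *m v t)) +
  (qform Q (state S v z y t) + qform Rc (v t)))); last first.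
  by move=> t _; rewrite stateD (qformD _ _ HQ.1) (qformD _ _ HR.1); ring.
by rewrite !big_split /= -!mulr_sumr !big_split /=; ring.
Qed.

(** * Optimality conditions along the worst-case trajectory *)

Section WorstCase.
Variables (gamma : R) (x0 : 'cV[R]_n).
Hypothesis Hgamma : gamma_low S T < gamma.

Local Notation xw := (wc_state S T gamma x0).
Local Notation ws := (wstar S T gamma x0).
Local Notation uw := (hinf_u S T gamma ws x0).
Local Notation lam t := (M gamma t *m xw t).

(** With [y = Lambda_t^-1 A x_t], the feedback and [w^*_t] cancel every term of [A x_t = Lambda_t y]
    except [y] itself. *)
Lemma hinf_state_wstar t : (t <= T)%N -> hinf_state S T gamma ws x0 t = xw t.
Proof.
elim: t => //= t IHt tT; rewrite IHt ?(ltnW tT) //.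
have uL := hinf_Lambda_unit HQ HQT HR Hgamma tT.
rewrite /hinf_K /ws -!mulmxA; set y := invmx _ *m _.
have -> : A *m xw t = hinf_Lambda S T gamma t *m y by rewrite mulKVmx.
rewrite /hinf_Lambda /hinf_Lambda_of mulmxDl mul1mx mulmxBl mulmxBl.
rewrite mul_scalar_mx -scalemxAl mulmxN -!mulmxA.
by rewrite addrAC -[y + _ + _]addrA subrK addrK.
Qed.

(** The Riccati recursion read as the adjoint equation. *)
Lemma costate_rec t : (t < T)%N -> Q *m xw t = lam t - A^T *m lam t.+1.
Proof.
by move=> tT; rewrite [M gamma t]hinf_M_rec //= mulmxDl -!mulmxA addrK.
Qed.

(** Stationarity of the Hamiltonian in the input. *)
Lemma costate_input t : (t < T)%N -> Rc *m uw t = - (B^T *m lam t.+1).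
Proof.
move=> tT; rewrite /hinf_u hinf_state_wstar ?(ltnW tT) // /hinf_K /= mulmxN.
by rewrite -!mulmxA mulKVmx // posdef_unitmx.
Qed.

(* Summation by parts against the costate: the first-order optimality
   condition for the H-infinity response to the worst-case disturbance. *)
Lemma cost_bilin_wstar v z :
  cost_bilin uw ws x0 v z 0 = \sum_(t < T) dot (lam t.+1) (z t).
Proof.
pose y := state S v z 0.
have partial k : (k <= T)%N ->
  \sum_(t < k) (dot (state S uw ws x0 t) (Q *m y t) + dot (uw t) (Rc *m v t))
  = \sum_(t < k) dot (lam t.+1) (z t) - dot (lam k) (y k).
  (* No boundary term arises at time 0 because [y] starts at 0. *)
  elim: k => [|k IHk] kT; first by rewrite !big_ord0 dot0r subr0.
  rewrite !big_ord_recr /= IHk ?(ltnW kT) // state_hinf_u hinf_state_wstar ?(ltnW kT) //.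
  rewrite (dot_sym _ _ HQ.1) (dot_sym _ _ HR.1) costate_rec // costate_input //.
  rewrite [y k.+1]/= -/(y k) !(dotDr, dotDl, dotNl) ![dot (_^T *m _) _]dot_mull.
  by rewrite !trmxK; ring.
rewrite /cost_bilin partial // state_hinf_u hinf_state_wstar // -/y.
(* The boundary term at [T] cancels the terminal cost, as [M_T = QT]. *)
by rewrite hinf_M_end (dot_sym _ _ HQT.1); ring.
Qed.

(* The cross terms with the optimal pair at w^* depend on the disturbance only,
   so they cancel between any two input sequences. *)
Lemma regret_le_cost_diff w v (D := fun t => w t - ws t) :
  cost S T (hinf_u S T gamma w x0) w x0 - cost S T v w x0 <=
  cost S T (hinf_u S T gamma D 0) D 0.
Proof.
have wE : w = fun t => ws t + D t by apply/funext => t; rewrite addrC subrK.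
(* The closed loop is linear, so its response to [w] is the one to [w^*] plus the response to [D]
   from 0. *)
have uE : hinf_u S T gamma w x0 = fun t => uw t + hinf_u S T gamma D 0 t.
  apply/funext => t; have := hinf_stateD gamma ws D x0 0 t.
  by rewrite addr0 -wE /hinf_u => ->; rewrite mulmxDr opprD.
have vE : v = fun t => uw t + (v t - uw t) by apply/funext => t; rewrite addrC subrK.
have -> : cost S T v w x0 = cost S T uw ws x0
  + 2 * cost_bilin uw ws x0 (fun t => v t - uw t) D 0
  + cost S T (fun t => v t - uw t) D 0.
  by rewrite -costD addr0 -vE -wE.
have -> : cost S T (hinf_u S T gamma w x0) w x0 = cost S T uw ws x0
  + 2 * cost_bilin uw ws x0 (hinf_u S T gamma D 0) D 0
  + cost S T (hinf_u S T gamma D 0) D 0.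
  by rewrite -costD addr0 -uE -wE.
rewrite !cost_bilin_wstar.
suff : 0 <= cost S T (fun t => v t - uw t) D 0 by lra.
rewrite /cost addr_ge0 ?HQT.2 // sumr_ge0 // => t _.
by rewrite addr_ge0 ?HQ.2 ?(posdef_psd HR).2.
Qed.

End WorstCase.

(** * Closed-loop cost from the zero initial state *)

Section ClosedLoop.
Variable gamma : R.

Local Notation P := (hinf_P S T gamma).
Local Notation F := (hinf_F S T gamma).
Local Notation K := (hinf_K S T gamma).

Lemma hinf_P_end : P T = QT.
Proof. exact: backward_end. Qed.

Lemma hinf_P_rec t : (t < T)%N ->
  P t = (F t)^T *m P t.+1 *m F t + Q + (K t)^T *m Rc *m K t.
Proof. by move=> tT; rewrite /hinf_P backward_rec. Qed.

Lemma hinf_P_psd t : (t <= T)%N -> psd (P t).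
Proof.
move=> tT; rewrite -(subKn tT); elim: (T - t)%N (leq_subr t T) => [|k IHk] kT.
  by rewrite subn0 hinf_P_end.
have ltT : (T - k.+1 < T)%N by lia.
rewrite hinf_P_rec // subnSK //; apply: psdD.
  by apply: psdD => //; apply: psd_congr; apply: IHk; exact: ltnW.
by apply: psd_congr; exact: posdef_psd.
Qed.

Lemma qform_hinf_P t x : (t < T)%N -> qform (P t) x =
  qform (P t.+1) (F t *m x) + qform Q x + qform Rc (K t *m x).
Proof.
by move=> tT; rewrite hinf_P_rec // !qformDm !qform_congr.
Qed.

Lemma hinf_stateS w x t : hinf_state S T gamma w x t.+1 =
  F t *m hinf_state S T gamma w x t + w t.
Proof. by rewrite /= mulmxN mulmxA -mulmxBl. Qed.

(** [P_t] is the undisturbed cost-to-go, so stage costs telescope against [qform (P t) (e t)]; only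
    terms containing [w] survive since [e] starts at 0. *)
Lemma hinf_cost w (e := hinf_state S T gamma w 0) :
  cost S T (hinf_u S T gamma w 0) w 0 =
  \sum_(t < T) (2 * dot (F t *m e t) (P t.+1 *m w t) + qform (P t.+1) (w t)).
Proof.
have partial k : (k <= T)%N -> qform (P k) (e k)
  + \sum_(t < k) (qform Q (state S (hinf_u S T gamma w 0) w 0 t)
                  + qform Rc (hinf_u S T gamma w 0 t)) =
  \sum_(t < k) (2 * dot (F t *m e t) (P t.+1 *m w t) + qform (P t.+1) (w t)).
  elim: k => [|k IHk] kT; first by rewrite !big_ord0 qform0 addr0.
  rewrite !big_ord_recr /= -IHk ?(ltnW kT) // state_hinf_u -/(e k).
  rewrite [e k.+1]hinf_stateS -/e (qformD _ _ (hinf_P_psd kT).1).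
  rewrite (qform_hinf_P _ kT) /hinf_u -/(e k).
  rewrite [qform Rc (- _)]qformE mulmxN dotNl dotNr opprK -qformE; ring.
by rewrite -partial // hinf_P_end /cost state_hinf_u.
Qed.

End ClosedLoop.
End Regret.

(** * Closed-loop cost bound *)

Section Convolution.
Context {R : realType}.
Variables (eta : R) (s b : nat -> R).
Hypotheses (eta_ge0 : 0 <= eta) (eta_lt1 : eta < 1).
Hypotheses (s0 : s 0%N = 0) (b_ge0 : forall t, 0 <= b t).

(** The geometric sum [1 + eta + ... + eta^(k-1)]. *)
Local Notation g k := ((1 - eta ^+ k) / (1 - eta)).

Lemma geom_sumS k : g k.+1 = eta * g k + 1.
Proof. by rewrite exprS; field; rewrite subr_eq0 gt_eqF. Qed.

Lemma geom_sum_ge0 k : 0 <= g k.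
Proof.
elim: k => [|k IHk]; first by rewrite expr0 subrr mul0r.
by rewrite geom_sumS addr_ge0 // mulr_ge0.
Qed.

Lemma geom_sum_le k l : (k <= l)%N -> g k <= g l.
Proof.
move=> kl; rewrite ler_wpM2r ?invr_ge0 ?subr_ge0 ?(ltW eta_lt1) //.
by rewrite lerD2l lerN2 ler_wiXn2l // ltW.
Qed.

(* Young's inequality on each pair b_k b_t of the convolution
   s_t = sum_(k < t) eta^(t-1-k) b_k; y_t below is the same convolution of the
   squares of b. *)
Lemma sum_convolution_le N :
  (forall t, (t < N)%N -> s t.+1 <= eta * s t + b t) ->
  \sum_(t < N) s t * b t <= g N * \sum_(t < N) b t ^+ 2.
Proof.
move=> sS.
pose y := fix y t := if t is t'.+1 then eta * y t' + b t' ^+ 2 else 0.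
have y_ge0 t : 0 <= y t.
  by elim: t => //= t yt; rewrite addr_ge0 ?mulr_ge0 ?sqr_ge0.
have young t c : (t <= N)%N -> 0 <= c -> 2 * (s t * c) <= y t + g t * c ^+ 2.
  move=> tN c0; elim: t tN => [|t IHt] tN.
    by rewrite s0 /= expr0 subrr !mul0r mulr0 addr0.
  have h1 : s t.+1 * c <= (eta * s t + b t) * c by rewrite ler_wpM2r ?sS.
  have h2 : eta * (2 * (s t * c)) <= eta * (y t + g t * c ^+ 2).
    by rewrite ler_wpM2l // IHt // ltnW.
  have := sqr_ge0 (b t - c); rewrite geom_sumS /=.
  move: h1 h2; move: (g t) (s t.+1) (s t) (y t) (b t) => G s' st yt bt h1 h2 h3.
  nra.
(* Summing the recursion of [y]; with [geom_sumS] this bounds the sum of [y] by induction. *)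
have yS k : \sum_(t < k) y t + y k = eta * (\sum_(t < k) y t) + \sum_(t < k) b t ^+ 2.
  elim: k => [|k IHk]; first by rewrite !big_ord0 mulr0 !addr0.
  by rewrite !big_ord_recr /= {1}IHk; ring.
have sumb_ge0 k : 0 <= \sum_(t < k) b t ^+ 2 by rewrite sumr_ge0 // => t _; rewrite sqr_ge0.
have sumy k : \sum_(t < k) y t <= g k * \sum_(t < k) b t ^+ 2.
  elim: k => [|k IHk]; first by rewrite !big_ord0 mulr0.
  rewrite big_ord_recr /= yS big_ord_recr /= mulrDr.
  rewrite ler_wpDr ?(mulr_ge0 (geom_sum_ge0 _)) ?sqr_ge0 // geom_sumS.
  by rewrite mulrDl mul1r lerD2r -mulrA ler_wpM2l.
have : \sum_(t < N) 2 * (s t * b t) <= \sum_(t < N) (y t + g N * b t ^+ 2).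
  apply: ler_sum => t _; apply: le_trans (young t (b t) (ltnW (ltn_ord t)) (b_ge0 t)) _.
  by rewrite lerD2l ler_wpM2r ?sqr_ge0 // geom_sum_le // ltnW.
rewrite -mulr_sumr big_split /= -mulr_sumr; have := sumy N; lra.
Qed.

End Convolution.

(** * The seminorm of a positive semidefinite matrix *)

Section PsdNorm.
Context {R : realType} {n : nat}.
Implicit Types (P : 'M[R]_n) (x y : 'cV[R]_n).

Definition psdnorm P x := Num.sqrt (qform P x).

Lemma psdnorm_ge0 P x : 0 <= psdnorm P x. Proof. exact: sqrtr_ge0. Qed.

Lemma psdnorm_sqr P x : psd P -> psdnorm P x ^+ 2 = qform P x.
Proof. by move=> pP; rewrite sqr_sqrtr ?pP.2. Qed.

Lemma dot_le_psdnorm P x y : psd P -> dot x (P *m y) <= psdnorm P x * psdnorm P y.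
Proof.
move=> pP; apply: le_trans (ler_norm _) _.
rewrite -(ler_pXn2r (ltn0Sn 1)) ?nnegrE ?mulr_ge0 ?psdnorm_ge0 //.
by rewrite real_normK ?num_real // exprMn !psdnorm_sqr // psd_cauchy_schwarz.
Qed.

Lemma psdnormD P x y : psd P -> psdnorm P (x + y) <= psdnorm P x + psdnorm P y.
Proof.
move=> pP; rewrite -(ler_pXn2r (ltn0Sn 1)) ?nnegrE ?addr_ge0 ?psdnorm_ge0 //.
rewrite sqrrD !psdnorm_sqr // (qformD _ _ pP.1).
have := dot_le_psdnorm x y pP; lra.
Qed.

End PsdNorm.

Lemma seqnorm_sqr (R : realType) n T (w : nat -> 'cV[R]_n) :
  seqnorm T w ^+ 2 = \sum_(t < T) dot (w t) (w t).
Proof.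
rewrite sqr_sqrtr; last by rewrite sumr_ge0 // => t _; exact: sqr_ge0.
by apply: eq_bigr => t _; rewrite vnorm_sqr.
Qed.

(** * Contraction of the closed loop and the resulting cost bound *)

Section ClosedLoopBound.
Context {R : realType} {n m : nat}.
Variables (S : lq_problem R n.+1 m) (T : nat) (gamma : R) (Pbar : 'M[R]_n.+1).

Local Notation Q := (costQ S).
Local Notation P := (hinf_P S T gamma).
Local Notation F := (hinf_F S T gamma).

Hypotheses (HT : (0 < T)%N).
Hypotheses (HQ : psd Q) (HQT : psd (costQT S)) (HR : posdef (costR S)).
Hypothesis HPsym : Pbar^T = Pbar.
Hypothesis HPinf : forall i, (i <= T)%N -> psd (Pbar - P i).
Hypothesis Hlmin : 0 < lambda_min Q.

Local Notation tau := (Num.sqrt (lambda_max Pbar / lambda_min Q)).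
Local Notation eta := (Num.sqrt (1 - 1 / tau ^+ 2)).

(** One step of the recursion at time 0, which exists as [T >= 1], shows that [P_0] dominates
    [Q]. *)
Lemma costQ_le_Pbar x : qform Q x <= qform Pbar x.
Proof.
apply: le_trans (psd_qform_le x (HPinf (leq0n T))).
rewrite (qform_hinf_P _ _ _ HT).
have := (hinf_P_psd HQ HQT HR gamma HT).2 (F 0 *m x).
have := (posdef_psd HR).2 (hinf_K S T gamma 0 *m x); lra.
Qed.

Lemma lambda_min_le_max : lambda_min Q <= lambda_max Pbar.
Proof.
have := @const1_neq0 R n; set x := const_mx 1; rewrite -dotxx_gt0 => x_gt0.
rewrite -(ler_pM2r x_gt0); apply: le_trans (lambda_min_qform x HQ.1) _.
exact: le_trans (costQ_le_Pbar x) (lambda_max_qform x HPsym).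
Qed.

Lemma spectral_norm_Pbar_gt0 : 0 < spectral_norm Pbar.
Proof.
have := @const1_neq0 R n; set x := const_mx 1; rewrite -dotxx_gt0 => x_gt0.
rewrite -(ltr_pM2r x_gt0) mul0r; apply: lt_le_trans (qform_le_spectral_norm Pbar x).
apply: lt_le_trans (costQ_le_Pbar x).
by apply: lt_le_trans (lambda_min_qform x HQ.1); rewrite mulr_gt0.
Qed.

Lemma tau_sqr : tau ^+ 2 = lambda_max Pbar / lambda_min Q.
Proof.
rewrite sqr_sqrtr // divr_ge0 ?(ltW Hlmin) //.
exact: le_trans (ltW Hlmin) lambda_min_le_max.
Qed.

Lemma tau_ge1 : 1 <= tau.
Proof.
by rewrite -[leLHS]sqrtr1 ler_wsqrtr // ler_pdivlMr // mul1r lambda_min_le_max.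
Qed.

Lemma eta_sqr : eta ^+ 2 = 1 - 1 / tau ^+ 2.
Proof.
have t1 := tau_ge1; have t0 : 0 < tau by exact: lt_le_trans t1.
by rewrite sqr_sqrtr // subr_ge0 ler_pdivrMr ?exprn_gt0 // mul1r exprn_ege1.
Qed.

Lemma eta_lt1 : eta < 1.
Proof.
have t1 := tau_ge1; have t0 : 0 < tau by exact: lt_le_trans t1.
rewrite -(ltr_pXn2r (ltn0Sn 1)) ?nnegrE ?sqrtr_ge0 ?ler01 // eta_sqr expr1n.
by rewrite gtrBl divr_gt0 // exprn_gt0.
Qed.

(** A step lowers the cost-to-go by at least [qform Q x], and [Q >= lambda_min(Q) I >= tau^-2 Pbar
    >= tau^-2 P_t]; hence the factor [1 - tau^-2 = eta^2]. *)
Lemma hinf_P_contraction t x : (t < T)%N ->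
  psdnorm (P t.+1) (F t *m x) <= eta * psdnorm (P t) x.
Proof.
move=> tT; have pP := hinf_P_psd HQ HQT HR gamma tT.
have pPt := hinf_P_psd HQ HQT HR gamma (ltnW tT).
rewrite -(ler_pXn2r (ltn0Sn 1)) ?nnegrE ?mulr_ge0 ?psdnorm_ge0 ?sqrtr_ge0 //.
rewrite exprMn !psdnorm_sqr // eta_sqr.
have PQ : 1 / tau ^+ 2 * qform (P t) x <= qform Q x.
  have lmax := lt_le_trans Hlmin lambda_min_le_max.
  rewrite tau_sqr div1r invf_div mulrAC ler_pdivrMr //.
  apply: le_trans (_ : _ <= lambda_min Q * (lambda_max Pbar * dot x x)) _.
    rewrite ler_pM2l //; apply: le_trans (lambda_max_qform x HPsym).
    exact: psd_qform_le (HPinf (ltnW tT)).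
  rewrite mulrCA mulrC ler_pM2r //; exact: lambda_min_qform HQ.1.
have := (posdef_psd HR).2 (hinf_K S T gamma t *m x).
rewrite mulrBl mul1r {1}(qform_hinf_P _ _ _ tT); lra.
Qed.

(** By contraction, [s_t = |e_t|] in the seminorm of [P_t] satisfies [s_(t+1) <= eta s_t + b_t] with
    [b_t = sqrt p |w_t|]; the convolution estimate then controls the cross terms. *)
Lemma hinf_cost_le w (d := seqnorm T w) :
  cost S T (hinf_u S T gamma w 0) w 0 <=
  spectral_norm Pbar * d ^+ 2 * (1 + 2 * eta * ((1 - eta ^+ T) / (1 - eta))).
Proof.
set p := spectral_norm Pbar; have p0 := spectral_norm_Pbar_gt0.
pose e := hinf_state S T gamma w 0.
pose s t := psdnorm (P t) (e t); pose b t := Num.sqrt p * vnorm (w t).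
have b_ge0 t : 0 <= b t by rewrite mulr_ge0 ?sqrtr_ge0 ?vnorm_ge0.
have b_sqr t : b t ^+ 2 = p * dot (w t) (w t).
  by rewrite exprMn sqr_sqrtr ?(ltW p0) // vnorm_sqr.
have wb t : (t < T)%N -> psdnorm (P t.+1) (w t) <= b t.
  move=> tT; rewrite -(ler_pXn2r (ltn0Sn 1)) ?nnegrE ?psdnorm_ge0 //.
  rewrite psdnorm_sqr ?b_sqr; last exact: hinf_P_psd.
  exact: le_trans (psd_qform_le _ (HPinf tT)) (qform_le_spectral_norm _ _).
have sS t : (t < T)%N -> s t.+1 <= eta * s t + b t.
  move=> tT; rewrite /s [e t.+1]hinf_stateS -/e.
  apply: le_trans (psdnormD _ _ _) _; first exact: hinf_P_psd.
  by apply: lerD; [exact: hinf_P_contraction | exact: wb].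
have s0 : s 0%N = 0 by rewrite /s /psdnorm qform0 sqrtr0.
have := sum_convolution_le (sqrtr_ge0 _) eta_lt1 s0 b_ge0 sS.
have sumb : \sum_(t < T) b t ^+ 2 = p * d ^+ 2.
  by rewrite seqnorm_sqr mulr_sumr; apply: eq_bigr => t _; rewrite b_sqr.
rewrite sumb => conv; rewrite hinf_cost -/e //.
apply: le_trans (_ : _ <= \sum_(t < T) (2 * eta * (s t * b t) + b t ^+ 2)) _.
  apply: ler_sum => t _; have tT := ltn_ord t; have pP := hinf_P_psd HQ HQT HR gamma tT.
  apply: lerD; last first.
    rewrite -psdnorm_sqr // ler_pXn2r ?nnegrE ?psdnorm_ge0 //; exact: wb.
  rewrite -mulrA ler_pM2l ?ltr0n // mulrA.
  apply: le_trans (dot_le_psdnorm _ _ pP) _.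
  apply: ler_pM; rewrite ?psdnorm_ge0 //; [exact: hinf_P_contraction | exact: wb].
rewrite big_split /= -mulr_sumr sumb.
have eta0 : 0 <= 2 * eta by rewrite mulr_ge0 ?sqrtr_ge0.
have := ler_wpM2l eta0 conv; lra.
Qed.

End ClosedLoopBound.

(** * Assembly of the regret bound *)

Lemma seqnormB_le2 (R : realType) n T (w z : nat -> 'cV[R]_n) :
  seqnorm T w <= 1 -> seqnorm T z <= 1 -> seqnorm T (fun t => w t - z t) <= 2.
Proof.
have sn_ge0 (v : nat -> 'cV[R]_n) : 0 <= seqnorm T v by exact: sqrtr_ge0.
move=> w1 z1; rewrite -(ler_pXn2r (ltn0Sn 1)) ?nnegrE ?sn_ge0 //.
have : seqnorm T w ^+ 2 <= 1 by rewrite expr_le1 ?sn_ge0.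
have : seqnorm T z ^+ 2 <= 1 by rewrite expr_le1 ?sn_ge0.
rewrite !seqnorm_sqr => z2 w2.
(* Termwise [|a - b|^2 <= 2 |a|^2 + 2 |b|^2], from [|a + b|^2 >= 0]. *)
apply: le_trans (_ : _ <= \sum_(t < T) (2 * dot (w t) (w t) + 2 * dot (z t) (z t))) _.
  apply: ler_sum => t _; have := dotxx_ge0 (w t + z t).
  rewrite !(dotDl, dotDr, dotNl, dotNr) (dotC (z t)); lra.
rewrite big_split /= -!mulr_sumr; lra.
Qed.

Theorem mainTheorem2 (R : realType) (n m : nat) (S : lq_problem R n m) (T : nat)
    (X gamma : R) (x0 : 'cV[R]_n) (w : nat -> 'cV[R]_n) (Pbar Hbar : 'M[R]_n)
    (HT : (0 < T)%N)
    (HQ : psd (costQ S)) (HQT : psd (costQT S)) (HR : posdef (costR S))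
    (Hdet : detectable (dynA S) (costQ S))
    (Hstab : stabilizable (dynA S) (dynB S))
    (HX : 0 < X) (Hx0 : vnorm x0 <= X)
    (Hadm : admissible_states S T x0)
    (Hgamma : gamma_low S T < gamma)
    (Hwstar : seqnorm T (wstar S T gamma x0) = 1)
    (Hw : seqnorm T w <= 1)
    (HPsym : Pbar^T = Pbar)
    (HP : forall i, (i <= T)%N -> psd (Pbar - lqr_P S T i))
    (HPinf : forall i, (i <= T)%N -> psd (Pbar - hinf_P S T gamma i))
    (HHsym : Hbar^T = Hbar)
    (HH : forall i, (0 < i <= T)%N ->
       psd (Hbar - dynB S *m invmx (costR S + (dynB S)^T *m lqr_P S T i *m dynB S)
                   *m (dynB S)^T))
    (* makes the quotient in tau well defined *)
    (Hlmin : 0 < lambda_min (costQ S)) :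
  let tau := Num.sqrt (lambda_max Pbar / lambda_min (costQ S)) in
  let eta := Num.sqrt (1 - 1 / tau ^+ 2) in
  let p := spectral_norm Pbar in
  let h := spectral_norm Hbar in
  let k2 := p * (2 + tau ^+ 2 * h * p * ((1 - eta ^+ T) ^+ 2 / (1 - eta) ^+ 2)) in
  let k1 := 2 * p * (2 + 2 * tau * eta * (2 + X) * ((1 - eta ^+ T) / (1 - eta))
                     + tau ^+ 2 * h * p * ((1 - eta ^+ T) ^+ 2 / (1 - eta) ^+ 2)) in
  let d := seqnorm T (fun t => w t - wstar S T gamma x0 t) in
  [/\ 0 < k1, 0 < k2 & hinf_regret S T gamma w x0 <= k1 * d + k2 * d ^+ 2].
Proof.
(* In dimension 0 the norm of [w^*] would be 0 instead of 1. *)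
destruct n as [|n].
  have wn t : vnorm (wstar S T gamma x0 t) = 0 by rewrite /vnorm big_ord0 sqrtr0.
  move/eqP: Hwstar; rewrite /seqnorm big1 => [|t _]; last by rewrite wn expr0n.
  by rewrite sqrtr0 eq_sym oner_eq0.
move=> tau eta p h k2 k1 d.
have p_gt0 : 0 < p := spectral_norm_Pbar_gt0 HT HQ HQT HR HPinf Hlmin.
have h_ge0 : 0 <= h := spectral_norm_ge0 Hbar.
have tau1 : 1 <= tau := tau_ge1 HT HQ HQT HR HPsym HPinf Hlmin.
have eta1 : eta < 1 := eta_lt1 HT HQ HQT HR HPsym HPinf Hlmin.
have eta0 : 0 <= eta := sqrtr_ge0 _.
have d0 : 0 <= d := sqrtr_ge0 _.
have d2 : d <= 2 by apply: seqnormB_le2 => //; rewrite Hwstar.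
have := hinf_cost_le HT HQ HQT HR HPsym HPinf Hlmin (fun t => w t - wstar S T gamma x0 t).
rewrite -/d -/tau -/eta -/p.
(* The comparison holds against every input sequence, in particular the offline one. *)
have := regret_le_cost_diff HQ HQT HR x0 Hgamma w (offline_u S T w x0).
rewrite -/(hinf_regret S T gamma w x0) /k1 /k2 -expr_div_n.
have := geom_sum_ge0 eta0 eta1 T.
move: (cost _ _ _ _ _) (hinf_regret _ _ _ _ _) => J r.
move: (_ / (1 - eta)) => g g_ge0 rJ Jle.
clear k1 k2; clearbody tau eta p h d.
set q := tau ^+ 2 * h * p * g ^+ 2.
have q_ge0 : 0 <= q := mulr_ge0 (mulr_ge0 (mulr_ge0 (sqr_ge0 _) h_ge0) (ltW p_gt0)) (sqr_ge0 _).
have eg : 0 <= eta * g by exact: mulr_ge0.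
(* Uses [tau (2 + X) >= 1]. *)
have lin : eta * g <= tau * eta * (2 + X) * g.
  have -> : tau * eta * (2 + X) * g = eta * g * (tau * (2 + X)) by ring.
  rewrite ler_peMr //; nra.
split; first by rewrite !mulr_gt0 //; lra.
  by rewrite mulr_gt0 //; lra.
have dd : d ^+ 2 <= 2 * d by rewrite expr2 ler_wpM2r.
apply: le_trans rJ (le_trans Jle _).
(* The bracket in [k1], so that [k1 = 2 p k]; it dominates the bracket of the closed-loop bound. *)
set k := 2 + _ + q.
have kE : 2 * eta * g + 1 <= k by rewrite /k; lra.
apply: le_trans (_ : _ <= p * k * d ^+ 2) _.
  by rewrite mulrAC ler_wpM2r ?sqr_ge0 // ler_pM2l //; lra.
(* Here [d <= 2] trades the quadratic term for the linear one. *)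
apply: le_trans (_ : _ <= p * k * (2 * d)) _.
  by rewrite ler_wpM2l // mulr_ge0 ?(ltW p_gt0) //; lra.
have : 0 <= p * (2 + q) * d ^+ 2 by rewrite !mulr_ge0 ?sqr_ge0 ?(ltW p_gt0) //; lra.
lra.
Qed.
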